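(* Suppose that $k\in\mathbb{N}_0\cup\{\infty\}$. For any closed subset $K$ of $\mathbb{R}^4\cong\mathbb{H}$, the space $\mathbb{H}^k[q^*,q]_{\mathrm{her}}\lceil K$ of restrictions to $K$ of the elements of $\mathbb{H}^k[q^*,q]_{\mathrm{her}}$ is an adapted linear subspace of $C(K;\mathbb{R})$.
   Context: $\mathbb{H}$ is the algebra of quaternions $q=x_0+x_1\mathrm{i}+x_2\mathrm{j}+x_3\mathrm{k}$, identified with $(x_0,x_1,x_2,x_3)\in\mathbb{R}^4$, with conjugation $q^*=x_0-x_1\mathrm{i}-x_2\mathrm{j}-x_3\mathrm{k}$. All polynomials are regarded as elements of the algebra $C(\mathbb{H};\mathbb{H})$ of continuous $\mathbb{H}$-valued functions on $\mathbb{H}$, with pointwise operations and involution $f^*(q):=f(q)^*$. Let $\Sigma=\{1,\mathrm{i},\mathrm{j},\mathrm{k}\}$; for a set $F$, $\mathrm{span}_{\mathbb{H}}F$ is the set of finite sums of elements $afb$ with $a,b\in\mathbb{H}$, $f\in F$. For $k\in\mathbb{N}_0$, $$\mathbb{H}^k[q^*,q]=\mathrm{span}_{\mathbb{H}}\{(q^* )^{m_0}q^{n_0}\sigma_1(q^* )^{m_1}q^{n_1}\cdots\sigma_k(q^* )^{m_k}q^{n_k}: m_0,n_0,\dots,m_k,n_k\in\mathbb{N}_0,\ \sigma_1,\dots,\sigma_k\in\Sigma\}$$ (for $k=0$ this is the span of the elements $(q^* )^{m}q^{n}$), and $\mathbb{H}^\infty[q^*,q]=\bigcup_{k=0}^\infty\mathbb{H}^k[q^*,q]$.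 Hermitian part: $\mathbb{H}^k[q^*,q]_{\mathrm{her}}:=\{f\in\mathbb{H}^k[q^*,q]: f=f^*\}$, a real vector space of real-valued functions. Adapted space: for a locally compact Hausdorff space $X$, a real linear subspace $E_{\mathbb{R}}$ of $C(X;\mathbb{R})$ (continuous real functions), with $E_+:=\{f\in E_{\mathbb{R}}: f\ge 0 \text{ on } X\}$, is called adapted if (i) $E_{\mathbb{R}}=E_+-E_+$; (ii) for each $x\in X$ there is $f\in E_+$ with $f(x)>0$; (iii) for each $f\in E_+$ there is $g\in E_+$ such that for every $\varepsilon>0$ there is a compact $K_\varepsilon\subseteq X$ with $f(x)\le\varepsilon g(x)$ for all $x\in X\setminus K_\varepsilon$. *)

(* Defs.v *)
From HB Require Import structures.
From mathcomp Require Import all_boot all_order all_algebra.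
From mathcomp Require Import ring.
From mathcomp Require Import all_classical all_reals all_analysis.

Set Implicit Arguments.
Unset Strict Implicit.
Unset Printing Implicit Defensive.

Import Order.TTheory GRing.Theory Num.Theory.
Import numFieldNormedType.Exports.

Local Open Scope classical_set_scope.
Local Open Scope ring_scope.

(* The quaternions are an alias of R^4, from which they inherit their real
   vector space structure and their topology; the multiplication is a ring
   structure on the alias only. *)
Definition quat (R : realType) : Type := 'rV[R]_4.

HB.instance Definition _ (R : realType) := NormedModule.on (quat R).

Section Quaternions.
Context {R : realType}.
Implicit Types p q : quat R.

Definition mkquat (x0 x1 x2 x3 : R) : quat R :=
  \row_(l < 4) [:: x0; x1; x2; x3]`_l.

Definition qc0 q : R := q ord0 (inord 0).
Definition qc1 q : R := q ord0 (inord 1).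
Definition qc2 q : R := q ord0 (inord 2).
Definition qc3 q : R := q ord0 (inord 3).

Definition qone : quat R := mkquat 1 0 0 0.
Definition qi : quat R := mkquat 0 1 0 0.
Definition qj : quat R := mkquat 0 0 1 0.
Definition qk : quat R := mkquat 0 0 0 1.

(* Hamilton's product: i^2 = j^2 = k^2 = ijk = -1. *)
Definition qmul p q : quat R := mkquat
  (qc0 p * qc0 q - qc1 p * qc1 q - qc2 p * qc2 q - qc3 p * qc3 q)
  (qc0 p * qc1 q + qc1 p * qc0 q + qc2 p * qc3 q - qc3 p * qc2 q)
  (qc0 p * qc2 q - qc1 p * qc3 q + qc2 p * qc0 q + qc3 p * qc1 q)
  (qc0 p * qc3 q + qc1 p * qc2 q - qc2 p * qc1 q + qc3 p * qc0 q).

Definition qconj q : quat R := mkquat (qc0 q) (- qc1 q) (- qc2 q) (- qc3 q).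

Lemma qc0_mk x0 x1 x2 x3 : qc0 (mkquat x0 x1 x2 x3) = x0.
Proof. by rewrite /qc0 mxE inordK. Qed.
Lemma qc1_mk x0 x1 x2 x3 : qc1 (mkquat x0 x1 x2 x3) = x1.
Proof. by rewrite /qc1 mxE inordK. Qed.
Lemma qc2_mk x0 x1 x2 x3 : qc2 (mkquat x0 x1 x2 x3) = x2.
Proof. by rewrite /qc2 mxE inordK. Qed.
Lemma qc3_mk x0 x1 x2 x3 : qc3 (mkquat x0 x1 x2 x3) = x3.
Proof. by rewrite /qc3 mxE inordK. Qed.
Definition mkquatE := (qc0_mk, qc1_mk, qc2_mk, qc3_mk).

Lemma quatP p q : qc0 p = qc0 q -> qc1 p = qc1 q -> qc2 p = qc2 q -> qc3 p = qc3 q ->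
  p = q.
Proof.
move=> h0 h1 h2 h3; apply/rowP => -[[|[|[|[|l]]]] lt_l4] //.
- by move: h0; rewrite /qc0; congr (p _ _ = q _ _); apply/val_inj; rewrite /= inordK.
- by move: h1; rewrite /qc1; congr (p _ _ = q _ _); apply/val_inj; rewrite /= inordK.
- by move: h2; rewrite /qc2; congr (p _ _ = q _ _); apply/val_inj; rewrite /= inordK.
- by move: h3; rewrite /qc3; congr (p _ _ = q _ _); apply/val_inj; rewrite /= inordK.
Qed.

Lemma qc0D p q : qc0 (p + q) = qc0 p + qc0 q. Proof. exact: mxE. Qed.
Lemma qc1D p q : qc1 (p + q) = qc1 p + qc1 q. Proof. exact: mxE. Qed.
Lemma qc2D p q : qc2 (p + q) = qc2 p + qc2 q. Proof. exact: mxE. Qed.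
Lemma qc3D p q : qc3 (p + q) = qc3 p + qc3 q. Proof. exact: mxE. Qed.
Definition qD := (qc0D, qc1D, qc2D, qc3D).

Lemma qmulA : associative qmul.
Proof. by move=> p q r; apply: quatP; rewrite /qmul !mkquatE; ring. Qed.

Lemma qmul1q : left_id qone qmul.
Proof. by move=> q; apply: quatP; rewrite /qmul !mkquatE; ring. Qed.

Lemma qmulq1 : right_id qone qmul.
Proof. by move=> q; apply: quatP; rewrite /qmul !mkquatE; ring. Qed.

Lemma qmulDl : left_distributive qmul +%R.
Proof. by move=> p q r; apply: quatP; rewrite !qD /qmul !mkquatE !qD; ring. Qed.

Lemma qmulDr : right_distributive qmul +%R.
Proof. by move=> p q r; apply: quatP; rewrite !qD /qmul !mkquatE !qD; ring. Qed.

Lemma qone_neq0 : qone != 0.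
Proof.
apply/eqP => /(congr1 qc0); rewrite qc0_mk /qc0 mxE => /eqP.
by rewrite oner_eq0.
Qed.

HB.instance Definition _ := GRing.Zmodule_isNzRing.Build (quat R)
  qmulA qmul1q qmulq1 qmulDl qmulDr qone_neq0.

Lemma qc0Z a q : qc0 (a *: q) = a * qc0 q. Proof. exact: mxE. Qed.
Lemma qc1Z a q : qc1 (a *: q) = a * qc1 q. Proof. exact: mxE. Qed.
Lemma qc2Z a q : qc2 (a *: q) = a * qc2 q. Proof. exact: mxE. Qed.
Lemma qc3Z a q : qc3 (a *: q) = a * qc3 q. Proof. exact: mxE. Qed.
Definition qZ := (qc0Z, qc1Z, qc2Z, qc3Z).

Lemma qmulE p q : p * q = qmul p q. Proof. by []. Qed.

Lemma qscaleAl (a : R) p q : a *: (p * q) = (a *: p) * q.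
Proof. by apply: quatP; rewrite !qmulE !qZ /qmul !mkquatE !qZ; ring. Qed.

Lemma qscaleAr (a : R) p q : a *: (p * q) = p * (a *: q).
Proof. by apply: quatP; rewrite !qmulE !qZ /qmul !mkquatE !qZ; ring. Qed.

HB.instance Definition _ :=
  GRing.Lmodule_isLalgebra.Build R (quat R) qscaleAl.
HB.instance Definition _ :=
  GRing.Lalgebra_isAlgebra.Build R (quat R) qscaleAr.

End Quaternions.

Section QuaternionicPolynomials.
Context {R : realType}.
Local Notation H := (quat R).

Definition Sigma : set H := [set 1; qi; qj; qk].

Definition spanH (F : set (H -> H)) : set (H -> H) :=
  [set g | exists (n : nat) (a b : 'I_n -> H) (f : 'I_n -> H -> H),
    (forall l, F (f l)) /\ g = fun q => \sum_(l < n) a l * f l q * b l].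

(* The word  c^{m_0} q^{n_0} s_1 c^{m_1} q^{n_1} ... s_k c^{m_k} q^{n_k},  where
   c is the conjugate of q.  The product is ordered by increasing l, and only
   m_0, ..., m_k, n_0, ..., n_k and s_1, ..., s_k matter. *)
Definition qmonom (k : nat) (m n : nat -> nat) (s : nat -> H) : H -> H :=
  fun q => qconj q ^+ m 0%N * q ^+ n 0%N *
    \prod_(l < k) (s l.+1 * qconj q ^+ m l.+1 * q ^+ n l.+1).

Definition qmonoms (k : nat) : set (H -> H) :=
  [set f | exists (m n : nat -> nat) (s : nat -> H),
    (forall l, (1 <= l <= k)%N -> Sigma (s l)) /\ f = qmonom k m n s].

(* [Some k] is the index k in N_0 and [None] is the index infinity. *)
Definition quat_poly (k : option nat) : set (H -> H) :=
  match k with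
  | Some k => spanH (qmonoms k)
  | None => \bigcup_(k in [set: nat]) spanH (qmonoms k)
  end.

Definition quat_poly_her (k : option nat) : set (H -> H) :=
  [set f | quat_poly k f /\ f = qconj \o f].

(* Hermitian elements take values in R, identified with R 1 in H. *)
Definition quat_poly_her_restr (k : option nat) (K : set H) : set (K -> R) :=
  [set g : K -> R |
     exists2 f, quat_poly_her k f & forall x : K, f (\val x) = (g x)%:A].

End QuaternionicPolynomials.

Arguments quat_poly_her_restr {R} k K _.

Section Adapted.
Context {R : realType} {X : topologicalType}.

Definition linear_subspaceC (E : set (X -> R)) : Prop :=
  [/\ E `<=` [set f | continuous f],
      E (fun=> 0) &
      forall (a : R) f g, E f -> E g -> E (fun x => a * f x + g x)].

Definition nonneg_part (E : set (X -> R)) : set (X -> R) :=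
  [set f | E f /\ forall x, 0 <= f x].

(* Being adapted only makes sense on locally compact Hausdorff spaces, which is
   why the definition includes this property of X. *)
Definition adapted (E : set (X -> R)) : Prop :=
  [/\ locally_compact [set: X] /\ hausdorff_space X,
      linear_subspaceC E,
      E = [set f - g | f in nonneg_part E & g in nonneg_part E],
      forall x, exists2 f, nonneg_part E f & 0 < f x &
      forall f, nonneg_part E f -> exists2 g, nonneg_part E g &
        forall eps : R, 0 < eps -> exists2 Keps : set X, compact Keps &
          forall x, ~ Keps x -> f x <= eps * g x].

End Adapted.

(* Main.v *)
(** Every element of [H^k[q^*,q]] is continuous and grows at most polynomially,
    while the real-valued weights [(1 + q^* q) ^ d] belong to [H^0[q^*,q]], hence
    to every [H^k[q^*,q]].  A Hermitian [f] with [|f| <= C (1 + q^* q) ^ d] is the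
    difference of the nonnegative functions [f + C (1 + q^* q) ^ d] and
    [C (1 + q^* q) ^ d], and it is dominated at infinity by
    [(1 + q^* q) ^ (d + 1)]. *)

Require Import Defs.
From mathcomp Require Import all_boot all_order all_algebra.
From mathcomp Require Import ring lra.
From mathcomp Require Import all_classical all_reals all_analysis.

Set Implicit Arguments.
Unset Strict Implicit.
Unset Printing Implicit Defensive.

Import Order.TTheory GRing.Theory Num.Theory.
Import numFieldNormedType.Exports.

Local Open Scope classical_set_scope.
Local Open Scope ring_scope.

(** * Topology of a closed subset seen as a subtype *)

Section Subtype.
Context {X : topologicalType} (K : set X).

Lemma set_val_continuous : continuous (\val : K -> X).
Proof. exact: initial_continuous. Qed.

Lemma hausdorff_subtype : hausdorff_space X -> hausdorff_space K.
Proof.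
move=> hX x y clxy; apply/val_inj/hX => A B nA nB.
have [z [Az Bz]] := clxy _ _ (set_val_continuous nA) (set_val_continuous nB).
by exists (\val z).
Qed.

(** A filter on [K] is pushed forward to [X], where it clusters in [B]&[K], compact because [K] is
    closed; the cluster point then lifts back to the subtype. *)
Lemma compact_subtype (B : set X) :
  closed K -> compact B -> compact (\val @^-1` B : set K).
Proof.
move=> clK cB F PF FB.
have cBK : compact (B `&` K) by exact: compact_closedI.
have FBK : (\val @ F) (B `&` K).
  by apply: (@filterS _ F) FB => -[x Kx] Bx; split=> //; exact: set_mem Kx.
have [p [[Bp Kp] clp]] := cBK _ _ FBK.
(* A neighbourhood in the subtype contains the trace on [K] of an open [W'] of [X], so clustering at
   [p] in [X] gives clustering at its lift. *)
exists (exist _ p (mem_set Kp)); split => // U V FU [W /= [[W' oW' <-] pW' WV]].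
have FU' : (\val @ F) (\val @` U) by apply: (@filterS _ F) FU => z Uz; exists z.
have [_ [[z Uz <-] W'z]] := clp _ _ FU' (open_nbhs_nbhs (conj oW' pW')).
by exists z; split => //; exact: WV.
Qed.

End Subtype.

(** * Squared Euclidean norm, conjugation and compact balls *)

Section Quaternions.
Context {R : realType}.
Local Notation H := (quat R).
Implicit Types (p q : H) (f g : H -> H).

Definition nsq q : R := qc0 q ^+ 2 + qc1 q ^+ 2 + qc2 q ^+ 2 + qc3 q ^+ 2.
Definition weight q : R := nsq q + 1.

Lemma nsq_ge0 q : 0 <= nsq q.
Proof. by rewrite !addr_ge0 ?sqr_ge0. Qed.

Lemma weight_ge1 q : 1 <= weight q.
Proof. by rewrite lerDr nsq_ge0. Qed.

Lemma weightX_ge1 q d : 1 <= weight q ^+ d.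
Proof. by rewrite exprn_ege1 ?weight_ge1. Qed.

(** Euler's four-square identity. *)
Lemma nsqM p q : nsq (p * q) = nsq p * nsq q.
Proof. by rewrite /nsq qmulE /qmul !mkquatE; ring. Qed.

(** Parallelogram law: the gap between the two sides is [nsq (p - q)]. *)
Lemma nsqD_le p q : nsq (p + q) <= 2 * (nsq p + nsq q).
Proof.
rewrite /nsq !qD -subr_ge0.
rewrite (_ : _ - _ = (qc0 p - qc0 q) ^+ 2 + (qc1 p - qc1 q) ^+ 2
  + (qc2 p - qc2 q) ^+ 2 + (qc3 p - qc3 q) ^+ 2); last by ring.
by rewrite !addr_ge0 ?sqr_ge0.
Qed.

Lemma nsq_qconj q : nsq (qconj q) = nsq q.
Proof. by rewrite /nsq !mkquatE; ring. Qed.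

Lemma qc_scalar (a : R) :
  [/\ qc0 (a%:A : H) = a, qc1 (a%:A : H) = 0, qc2 (a%:A : H) = 0
    & qc3 (a%:A : H) = 0].
Proof. by rewrite !qZ !mkquatE mulr1 !mulr0. Qed.

Lemma nsq_scalar (a : R) : nsq (a%:A : H) = a ^+ 2.
Proof. by rewrite /nsq; have [-> -> -> ->] := qc_scalar a; ring. Qed.

Lemma qconj_scalar (a : R) : qconj (a%:A : H) = a%:A.
Proof.
have [a0 a1 a2 a3] := qc_scalar a.
by apply: quatP; rewrite !mkquatE ?a1 ?a2 ?a3 ?oppr0.
Qed.

Lemma qconj_linear (a : R) p q : qconj (a *: p + q) = a *: qconj p + qconj q.
Proof. by apply: quatP; rewrite !mkquatE !qD !qZ !mkquatE; ring. Qed.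

Lemma qconj_mul_self q : qconj q * q = (nsq q)%:A.
Proof.
have [a0 a1 a2 a3] := qc_scalar (nsq q).
by apply: quatP; rewrite ?a0 ?a1 ?a2 ?a3 qmulE !mkquatE /nsq; ring.
Qed.

Lemma self_mul_qconj q : q * qconj q = (nsq q)%:A.
Proof.
have [a0 a1 a2 a3] := qc_scalar (nsq q).
by apply: quatP; rewrite ?a0 ?a1 ?a2 ?a3 qmulE !mkquatE /nsq; ring.
Qed.

(** [q] commutes with its conjugate, both products being the scalar [nsq q]. *)
Lemma qconjX_mul_selfX q d : qconj q ^+ d * q ^+ d = (nsq q ^+ d)%:A.
Proof.
rewrite -exprMn_comm; last by rewrite /GRing.comm qconj_mul_self self_mul_qconj.
by rewrite qconj_mul_self exprZn expr1n.
Qed.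

(* [`|q|] is the sup norm inherited from ['rV[R]_4]. *)
Lemma norm_le_weight q : `|q| <= weight q.
Proof.
have sqr_le (x : R) : `|x| <= x ^+ 2 + 1.
  by rewrite ler_norml; apply/andP; split; nra.
have [s0 s1 s2 s3] := And4 (sqr_ge0 (qc0 q)) (sqr_ge0 (qc1 q)) (sqr_ge0 (qc2 q))
  (sqr_ge0 (qc3 q)).
rewrite [leLHS]/Num.Def.normr/= mx_normrE.
apply: bigmax_le; first by rewrite (le_trans _ (weight_ge1 q)).
move=> [i j] _ /=; rewrite ord1; apply: (le_trans (sqr_le _)).
rewrite lerD2r -[j]inord_val; case: j => [[|[|[|[|j]]]] lt_j4] //=;
  rewrite /nsq /qc0 /qc1 /qc2 /qc3 in s0 s1 s2 s3 *; lra.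
Qed.

Lemma compact_quat_ball (M : R) : compact [set q : H | `|q| <= M].
Proof.
apply: bounded_closed_compact.
  by exists M; split => [|x Mx q /= /le_trans]; [exact: num_real|apply; exact: ltW].
rewrite (_ : mkset _ = (fun q : H => `|q|) @^-1` [set x | x <= M]) //.
by apply: preimage_closed; [move=> x _; exact: norm_continuous|exact: closed_le].
Qed.

(** * Continuity and polynomial growth of quaternionic polynomials *)

Definition qcontinuous f := [/\ continuous (qc0 \o f), continuous (qc1 \o f),
  continuous (qc2 \o f) & continuous (qc3 \o f)].

Definition poly_bounded f :=
  exists C d, forall q, nsq (f q) <= C * weight q ^+ d.

(** The invariant carried through the construction of polynomials. All four components are tracked
    because a product mixes them, although a Hermitian element only has a real part. *)
Definition tame f := qcontinuous f /\ poly_bounded f.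

Lemma tame_cst p : tame (fun=> p).
Proof.
split; first by split; exact: cst_continuous.
by exists (nsq p), 0%N => q; rewrite expr0 mulr1.
Qed.

Lemma tame_id : tame id.
Proof.
split; first by split; exact: coord_continuous.
by exists 1, 1%N => q; rewrite mul1r expr1 lerDl.
Qed.

Lemma tame_qconj f : tame f -> tame (qconj \o f).
Proof.
move=> [[f0 f1 f2 f3] [C [d fC]]]; split; last first.
  by exists C, d => q /=; rewrite nsq_qconj.
have c0 : qc0 \o (qconj \o f) = qc0 \o f.
  by apply/funext => q; rewrite /= qc0_mk.
have c1 : qc1 \o (qconj \o f) = fun q => - qc1 (f q).
  by apply/funext => q; rewrite /= qc1_mk.
have c2 : qc2 \o (qconj \o f) = fun q => - qc2 (f q).
  by apply/funext => q; rewrite /= qc2_mk.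
have c3 : qc3 \o (qconj \o f) = fun q => - qc3 (f q).
  by apply/funext => q; rewrite /= qc3_mk.
rewrite /qcontinuous c0 c1 c2 c3.
have hN (a : H -> R) : continuous a -> continuous (fun x => - a x).
  by move=> ca x; exact: continuousN (ca x).
by split; [|exact: hN|exact: hN|exact: hN].
Qed.

Lemma tameD f g : tame f -> tame g -> tame (fun q => f q + g q).
Proof.
move=> [[f0 f1 f2 f3] [C [d fC]]] [[g0 g1 g2 g3] [D [e gD]]]; split.
  have hD (a b : H -> R) : continuous a -> continuous b -> continuous (a \+ b).
    by move=> ca cb x; exact: continuousD (ca x) (cb x).
  have c0 : qc0 \o (fun q => f q + g q) = (qc0 \o f) \+ (qc0 \o g).
    by apply/funext => q; rewrite /= qD.
  have c1 : qc1 \o (fun q => f q + g q) = (qc1 \o f) \+ (qc1 \o g).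
    by apply/funext => q; rewrite /= qD.
  have c2 : qc2 \o (fun q => f q + g q) = (qc2 \o f) \+ (qc2 \o g).
    by apply/funext => q; rewrite /= qD.
  have c3 : qc3 \o (fun q => f q + g q) = (qc3 \o f) \+ (qc3 \o g).
    by apply/funext => q; rewrite /= qD.
  by rewrite /qcontinuous c0 c1 c2 c3; split; exact: hD.
(* The factor 2 comes from [nsqD_le]; since weights are at least 1, the exponent [d + e] dominates
   both [d] and [e]. The signs of [C] and [D] are unknown, but each bound is nonnegative because it
   majorizes some [nsq]. *)
exists (2 * (C + D)), (d + e)%N => q.
apply: (le_trans (nsqD_le _ _)).
have C0 : 0 <= C * weight q ^+ d := le_trans (nsq_ge0 _) (fC q).
have D0 : 0 <= D * weight q ^+ e := le_trans (nsq_ge0 _) (gD q).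
rewrite -mulrA ler_pM2l// mulrDl exprD lerD//.
  apply: (le_trans (fC q)).
  by rewrite mulrA ler_peMr ?weightX_ge1.
apply: (le_trans (gD q)).
by rewrite [_ ^+ d * _]mulrC mulrA ler_peMr ?weightX_ge1.
Qed.

Lemma tameM f g : tame f -> tame g -> tame (fun q => f q * g q).
Proof.
move=> [[f0 f1 f2 f3] [C [d fC]]] [[g0 g1 g2 g3] [D [e gD]]]; split.
  have hc (a b : H -> R) : continuous a -> continuous b ->
      continuous (fun x => a x * b x).
    by move=> ca cb x; exact: continuousM (ca x) (cb x).
  have hD (a b : H -> R) : continuous a -> continuous b ->
      continuous (fun x => a x + b x).
    by move=> ca cb x; exact: continuousD (ca x) (cb x).
  have hB (a b : H -> R) : continuous a -> continuous b ->
      continuous (fun x => a x - b x).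
    by move=> ca cb x; exact: continuousB (ca x) (cb x).
  split.
  - rewrite (_ : _ \o _ = fun q => qc0 (f q) * qc0 (g q) - qc1 (f q) * qc1 (g q)
      - qc2 (f q) * qc2 (g q) - qc3 (f q) * qc3 (g q)).
      by apply: (hB _ _); [apply: (hB _ _); [apply: (hB _ _)|]|]; exact: hc.
    by apply/funext => q; rewrite /= qmulE qc0_mk.
  - rewrite (_ : _ \o _ = fun q => qc0 (f q) * qc1 (g q) + qc1 (f q) * qc0 (g q)
      + qc2 (f q) * qc3 (g q) - qc3 (f q) * qc2 (g q)).
      by apply: (hB _ _); [apply: (hD _ _); [apply: (hD _ _)|]|]; exact: hc.
    by apply/funext => q; rewrite /= qmulE qc1_mk.
  - rewrite (_ : _ \o _ = fun q => qc0 (f q) * qc2 (g q) - qc1 (f q) * qc3 (g q)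
      + qc2 (f q) * qc0 (g q) + qc3 (f q) * qc1 (g q)).
      by apply: (hD _ _); [apply: (hD _ _); [apply: (hB _ _)|]|]; exact: hc.
    by apply/funext => q; rewrite /= qmulE qc2_mk.
  - rewrite (_ : _ \o _ = fun q => qc0 (f q) * qc3 (g q) + qc1 (f q) * qc2 (g q)
      - qc2 (f q) * qc1 (g q) + qc3 (f q) * qc0 (g q)).
      by apply: (hD _ _); [apply: (hB _ _); [apply: (hD _ _)|]|]; exact: hc.
    by apply/funext => q; rewrite /= qmulE qc3_mk.
exists (C * D), (d + e)%N => q.
by rewrite nsqM exprD mulrACA ler_pM ?nsq_ge0.
Qed.

Lemma tameX f n : tame f -> tame (fun q => f q ^+ n).
Proof.
move=> tf; elim: n => [|n ihn]; first exact: tame_cst.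
by under eq_fun do rewrite exprS; exact: tameM.
Qed.

Lemma tame_sum n (F : 'I_n -> H -> H) :
  (forall l, tame (F l)) -> tame (fun q => \sum_(l < n) F l q).
Proof.
elim: n F => [F _|n ihn F tF].
  by under eq_fun do rewrite big_ord0; exact: tame_cst.
by under eq_fun do rewrite big_ord_recr; apply: tameD => //; exact: ihn.
Qed.

Lemma tame_prod n (F : 'I_n -> H -> H) :
  (forall l, tame (F l)) -> tame (fun q => \prod_(l < n) F l q).
Proof.
elim: n F => [F _|n ihn F tF].
  by under eq_fun do rewrite big_ord0; exact: tame_cst.
by under eq_fun do rewrite big_ord_recr; apply: tameM => //; exact: ihn.
Qed.

Lemma tame_qmonom k m n s : tame (qmonom (R := R) k m n s).
Proof.
have tc j : tame (fun q => qconj q ^+ j) by apply/tameX/tame_qconj/tame_id.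
have ti j : tame (fun q => q ^+ j) by exact/tameX/tame_id.
apply: tameM; first exact: tameM.
by apply: tame_prod => l; apply: tameM => //; apply: tameM => //; exact: tame_cst.
Qed.

Lemma tame_spanH k f : spanH (qmonoms k) f -> tame f.
Proof.
move=> [n [a [b [F [monF ->]]]]]; apply: tame_sum => l.
apply: tameM; last exact: tame_cst.
apply: tameM; first exact: tame_cst.
by have [m [n' [s [_ ->]]]] := monF l; exact: tame_qmonom.
Qed.

Lemma tame_quat_poly k f : quat_poly k f -> tame f.
Proof. by case: k => [k|[k _]]; exact: tame_spanH. Qed.

(** * Linear structure and inclusions of the polynomial spaces *)

Lemma spanH_linear (F : set (H -> H)) (a : R) f g :
  spanH F f -> spanH F g -> spanH F (fun q => a *: f q + g q).
Proof.
move=> [n [b [c [u [Fu ->]]]]] [n' [b' [c' [u' [Fu' ->]]]]].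
(* The two families are concatenated, and the real scalar [a] is absorbed into the left coefficients
   of the first. *)
exists (n + n')%N.
exists (fun l => match fintype.split l with inl i => a *: b i | inr i => b' i end).
exists (fun l => match fintype.split l with inl i => c i | inr i => c' i end).
exists (fun l => match fintype.split l with inl i => u i | inr i => u' i end).
split=> [l|]; first by case: (fintype.split l).
apply/funext => q; rewrite big_split_ord/= scaler_sumr; congr (_ + _).
  apply: eq_bigr => i _.
  by rewrite (unsplitK (inl i : 'I_n + 'I_n')) !scalerAl.
by apply: eq_bigr => i _; rewrite (unsplitK (inr i : 'I_n + 'I_n')).
Qed.

Lemma spanH_sub (F G : set (H -> H)) : F `<=` G -> spanH F `<=` spanH G.
Proof.
by move=> FG f [n [a [b [u [Fu ->]]]]]; exists n, a, b, u; split=> // l; exact: FG.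
Qed.

(** A word is lengthened by a trivial last block with letter 1 and both exponents 0. The given
    sequences are arbitrary beyond [k], hence the truncations. *)
Lemma qmonomsS k : @qmonoms R k `<=` qmonoms k.+1.
Proof.
move=> f [m [n [s [Ss ->]]]].
exists (fun l => if (l <= k)%N then m l else 0%N).
exists (fun l => if (l <= k)%N then n l else 0%N).
exists (fun l => if (l <= k)%N then s l else 1); split.
  move=> l /andP[l1 _]; case: ifPn => [lk|_]; first by apply: Ss; rewrite l1.
  by left; left; left.
apply/funext => q; rewrite /qmonom big_ord_recr/= ltnn !mulr1.
by congr (_ * _); apply: eq_bigr => i _; rewrite ltn_ord.
Qed.

Lemma qmonoms_sub k k' : (k <= k')%N -> @qmonoms R k `<=` qmonoms k'.
Proof.
move=> /subnK <-; elim: (k' - k)%N => // n ihn.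
exact: subset_trans ihn (@qmonomsS _).
Qed.

Lemma quat_poly_linear k (a : R) f g : quat_poly k f -> quat_poly k g ->
  quat_poly k (fun q => a *: f q + g q).
Proof.
case: k => [k|[k _ Pf] [k' _ Pg]]; first exact: spanH_linear.
(* For the index infinity, both elements are moved to a common finite level. *)
exists (maxn k k') => //; apply: spanH_linear.
  exact: spanH_sub (qmonoms_sub (leq_maxl k k')) _ Pf.
exact: spanH_sub (qmonoms_sub (leq_maxr k k')) _ Pg.
Qed.

(** Binomial expansion of [(1 + nsq q) ^+ d], in which the power [nsq q ^+ l] is the word
    [qconj q ^+ l * q ^+ l]. *)
Lemma spanH_weightX d : spanH (qmonoms 0) (fun q : H => (weight q ^+ d)%:A).
Proof.
exists d.+1, (fun l => 'C(d, l)%:R), (fun=> 1).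
exists (fun l : 'I_d.+1 => qmonom 0 (fun=> l : nat) (fun=> l : nat) (fun=> 1)).
split=> [l|]; first by eexists _, _, _; split => // -[|].
apply/funext => q; rewrite /weight addrC exprDn scaler_suml.
apply: eq_bigr => l _.
rewrite /qmonom big_ord0 !mulr1 qconjX_mul_selfX expr1n mul1r.
by rewrite mulr_natl scalerMnl.
Qed.

Lemma quat_poly_weightX k d : quat_poly k (fun q : H => (weight q ^+ d)%:A).
Proof.
have H0 := spanH_weightX d.
case: k => [k|]; last by exists 0%N.
exact: spanH_sub (qmonoms_sub (leq0n k)) _ H0.
Qed.

End Quaternions.

(** * Restrictions of Hermitian elements to [K] *)

Section Restriction.
Context {R : realType} (k : option nat) (K : set (quat R)).
Local Notation E := (quat_poly_her_restr k K).

Lemma restr_weightX d : E (fun x => weight (\val x) ^+ d).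
Proof.
exists (fun q => (weight q ^+ d)%:A) => //; split; first exact: quat_poly_weightX.
by apply/funext => q; rewrite /= qconj_scalar.
Qed.

Lemma restr_linear (a : R) f g : E f -> E g -> E (fun x => a * f x + g x).
Proof.
move=> [F [PF hF] Ff] [G [PG hG] Gg].
exists (fun q => a *: F q + G q) => [|x]; last first.
  by rewrite Ff Gg scalerDl scalerA.
split; first exact: quat_poly_linear.
by apply/funext => q; rewrite /= qconj_linear {1}hF {1}hG.
Qed.

Lemma restr0 : E (fun=> 0).
Proof.
have := restr_linear (-1) (restr_weightX 0) (restr_weightX 0).
by congr (E _); apply/funext => x; rewrite mulN1r addNr.
Qed.

Lemma restr_continuous f : E f -> continuous f.
Proof.
move=> [F [/tame_quat_poly[[cF _ _ _] _] _] Ff].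
(* On [K] the polynomial [F] equals [f] times the unit, so [f] is its real part. *)
rewrite (_ : f = (qc0 \o F) \o \val); last first.
  by apply/funext => x; rewrite /= Ff; have [->] := @qc_scalar R (f x).
by move=> x; apply: continuous_comp; [exact: set_val_continuous|exact: cF].
Qed.

Lemma restr_bounded f : E f ->
  exists2 C, 0 <= C & exists d, forall x, `|f x| <= C * weight (\val x) ^+ d.
Proof.
move=> [F [/tame_quat_poly[_ [C [d FC]]] _] Ff].
(* The growth bound controls the square of [f], and [|f| <= f ^+ 2 + 1]; the extra 1 is absorbed by
   one more copy of the weight power, which is at least 1. *)
exists (`|C| + 1); first by rewrite addr_ge0.
exists d => x; rewrite mulrDl mul1r.
have := FC (\val x); rewrite Ff nsq_scalar => fC.
have w1 := weightX_ge1 (\val x) d.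
have CC : C * weight (\val x) ^+ d <= `|C| * weight (\val x) ^+ d.
  by rewrite ler_wpM2r ?ler_norm// (le_trans _ w1).
rewrite (@le_trans _ _ (f x ^+ 2 + 1)) ?lerD ?(le_trans fC)//.
by rewrite ler_norml; apply/andP; split; nra.
Qed.

End Restriction.

(** * Verification of the axioms of an adapted space *)

Theorem proposition4p15 (R : realType) (k : option nat) (K : set (quat R))
    (clK : closed K) : adapted (quat_poly_her_restr k K).
Proof.
have hK : hausdorff_space K by apply/hausdorff_subtype/norm_hausdorff.
(* These compact sets serve both for local compactness and as the exceptional sets of the domination
   axiom. *)
pose B M : set K := \val @^-1` [set q | `|q| <= M].
have cB M : compact (B M) by apply: compact_subtype => //; exact: compact_quat_ball.
split.
(* By the triangle inequality this set contains the trace on [K] of the unit ball around [x]. *)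
- split=> // x _; rewrite withinET; exists (B (`|\val x| + 1)); last first.
    by split; [exact: cB|exact: compact_closed].
  have nx : nbhs x (\val @^-1` ball (\val x) 1).
    exact/set_val_continuous/nbhsx_ballx.
  apply: filterS nx => y; rewrite -ball_normE/= => /ltW xy.
  rewrite /B /= -(subKr (\val x) (\val y)) (le_trans (ler_normB _ _))//.
  by rewrite lerD2l.
- by split; [exact: restr_continuous|exact: restr0|exact: restr_linear].
- apply/seteqP; split=> [f Ef|_ [f [Ef _]] [g [Eg _] <-]]; last first.
    have := restr_linear (-1) Eg Ef.
    by congr (quat_poly_her_restr _ _ _); apply/funext => x; rewrite mulN1r addrC.
  have [C C0 [d fC]] := restr_bounded Ef.
  (* [h] majorizes the absolute value of [f], so [f = (f + h) - h] is the required decomposition. *)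
  pose h (x : K) := C * weight (\val x) ^+ d.
  have Eh : quat_poly_her_restr k K h.
    have := restr_linear C (restr_weightX k K d) (restr0 k K).
    by congr (quat_poly_her_restr _ _ _); apply/funext => x; rewrite addr0.
  exists (f + h); [split|exists h; [split|]] => //.
  + have := restr_linear 1 Ef Eh.
    by congr (quat_poly_her_restr _ _ _); apply/funext => x; rewrite mul1r.
  + move=> x; have /ler_normlP[fx _] := fC x.
    by rewrite -[_ x]/(f x + h x) -lerBlDr sub0r lerNl.
  + by move=> x; rewrite mulr_ge0// (le_trans _ (weightX_ge1 _ _)).
  + by rewrite addrK.
(* The zeroth power of the weight is the constant 1, positive everywhere. *)
- move=> x; exists (fun x => weight (\val x) ^+ 0); rewrite ?expr0//.
  by split; [exact: restr_weightX|move=> y; rewrite expr0].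
- move=> f [Ef f0]; have [C C0 [d fC]] := restr_bounded Ef.
  exists (fun x => weight (\val x) ^+ d.+1).
    split; first exact: restr_weightX.
    by move=> x; rewrite (le_trans _ (weightX_ge1 _ _)).
  (* Outside this set [C / eps < |x| <= weight x], so [C] is at most [eps] times the weight; this
     pays for the one extra power of the weight. *)
  move=> eps eps0; exists (B (C / eps)); first exact: cB.
  move=> x /negP; rewrite -ltNge => xM.
  rewrite (le_trans (ler_norm _))// (le_trans (fC x))// exprS mulrA ler_wpM2r//.
    by rewrite (le_trans _ (weightX_ge1 _ _)).
  rewrite mulrC -ler_pdivrMr// ltW// (lt_le_trans xM)//.
  exact: norm_le_weight.
Qed.
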